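(* Let $S$ be a closed symmetric linear relation in a Hilbert space $\mathfrak H$, let $\mathcal H,\mathcal K$ be Hilbert spaces, and let $\Gamma:\mathfrak H^2\to\mathcal H^2$ be a boundary relation for $S^*$ with $\gamma$-field $\gamma(\lambda)$ and Weyl family $M(\lambda)$. Let $W$ be a linear relation from the Kreĭn space $(\mathcal H^2,J_{\mathcal H})$ to the Kreĭn space $(\mathcal K^2,J_{\mathcal K})$ such that $W\Gamma$ is unitary (from $(\mathfrak H^2,J_{\mathfrak H})$ to $(\mathcal K^2,J_{\mathcal K})$) and $\ker W=\{0\}$. Then: (i) the relation $W\Gamma:\mathfrak H^2\to\mathcal K^2$ is a boundary relation for $S^*$; (ii) the $\gamma$-field $\gamma_W(\lambda)$ associated with $W\Gamma$ is given by $$\gamma_W(\lambda)=\{\,\{k,f_\lambda\}\in\mathcal K\times\mathfrak H:\ \{\widehat h,\widehat k\}\in W,\ \{\widehat f_\lambda,\widehat h\}\in\Gamma\text{ for some }\widehat h\,\},\quad\lambda\in\mathbb C\setminus\mathbb R,$$ where $\widehat k=\{k,k'\}$ and $\widehat f_\lambda=\{f_\lambda,\lambda f_\lambda\}$; (iii) the Weyl family $M_W(\lambda)$ corresponding to $W\Gamma$ is given by the Shmul'yan transform $$M_W(\lambda)=W[M(\lambda)],\quad\lambda\in\mathbb C\setminus\mathbb R.$$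
   Context: A linear relation from $\mathfrak H_1$ to $\mathfrak H_2$ is a linear subspace of $\mathfrak H_1\times\mathfrak H_2$. The product is $W\Gamma=\{\{\widehat f,\widehat k\}:\{\widehat f,\widehat h\}\in\Gamma,\{\widehat h,\widehat k\}\in W\text{ for some }\widehat h\}$. For a Hilbert space $\mathcal H$, $\mathcal H^2=\mathcal H\oplus\mathcal H$ is a Kreĭn space $(\mathcal H^2,J_{\mathcal H})$ with fundamental symmetry $J_{\mathcal H}=\begin{pmatrix}0&-iI\\ iI&0\end{pmatrix}$, i.e. $[\widehat h,\widehat k]=(J_{\mathcal H}\widehat h,\widehat k)=-i[(h',k)-(h,k')]$ for $\widehat h=\{h,h'\},\widehat k=\{k,k'\}$. A linear relation $\Gamma$ between Kreĭn spaces is unitary if $\Gamma^{-1}=\Gamma^{[*]}$, where $\Gamma^{[*]}$ is the adjoint with respect to the indefinite inner products. Boundary relation: for a closed symmetric linear relation $S$ in $\mathfrak H$, a linear relation $\Gamma:\mathfrak H^2\to\mathcal H^2$ is a boundary relation for $S^*$ if (G1) $\operatorname{dom}\Gamma$ is dense in $S^*$ and $(f',g)_{\mathfrak H}-(f,g')_{\mathfrak H}=(h',k)_{\mathcal H}-(h,k')_{\mathcal H}$ for all $\{\widehat f,\widehat h\},\{\widehat g,\widehat k\}\in\Gamma$; (G2) every $\{\widehat g,\widehat k\}\in\mathfrak H^2\times\mathcal H^2$ satisfying this identity for all $\{\widehat f,\widehat h\}\in\Gamma$ belongs to $\Gamma$. The Weyl family of $\Gamma$ is $M(\lambda)=\{\widehat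 h\in\mathcal H^2:\{\widehat f_\lambda,\widehat h\}\in\Gamma\text{ for some }\widehat f_\lambda=\{f,\lambda f\}\in\mathfrak H^2\}$ and the $\gamma$-field is $\gamma(\lambda)=\{\{h,f_\lambda\}\in\mathcal H\times\mathfrak H:\{\widehat f_\lambda,\widehat h\}\in\Gamma\text{ for some }\widehat f_\lambda=\{f_\lambda,\lambda f_\lambda\},\ \widehat h=\{h,h'\}\}$, $\lambda\in\mathbb C\setminus\mathbb R$. Shmul'yan transform: for a linear relation $\Theta\subset\mathcal H^2$ in $\mathcal H$, $W[\Theta]=\{\widehat k\in\mathcal K^2:\{\widehat h,\widehat k\}\in W\text{ for some }\widehat h\in\Theta\}$. *)

(* Defs.v *)
From HB Require Import structures.
From mathcomp Require Import all_boot all_order all_algebra.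
From mathcomp Require Import all_classical all_reals all_analysis.
From mathcomp Require Import sesquilinear complex.

Set Implicit Arguments.
Unset Strict Implicit.
Unset Printing Implicit Defensive.

Import Order.TTheory GRing.Theory Num.Theory.
Import numFieldNormedType.Exports.

Local Open Scope classical_set_scope.
Local Open Scope relation_scope.
Local Open Scope ring_scope.

(* Complex Hilbert spaces.  The inner product [dotp] is a [{dot _ for _}], so
   it is linear in its first and conjugate-linear in its second argument. *)
HB.mixin Record CompleteNormedModule_isHilbert (R : realType) H
    of CompleteNormedModule R[i] H := {
  dotp : {dot H for @Num.conj R[i]} ;
  sqr_norm_dotp : forall x : H, `|x| ^+ 2 = dotp x x
}.

#[short(type="hilbertType")]
HB.structure Definition Hilbert (R : realType) :=
  { H of CompleteNormedModule R[i] H & CompleteNormedModule_isHilbert R H }.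

Notation "'[ u , v ]" := (dotp u%R v%R) : ring_scope.

Section Relations.
Variables (K : nzRingType) (U V : lmodType K).

(* A linear relation from U to V is (the graph of) a linear subspace of
   U x V; the pair {u, v} is encoded as [(u, v)]. *)
Definition linear_relation (T : set (U * V)) :=
  GRing.submod_closed [pred p | p \in T].

Definition ker_rel (T : set (U * V)) : set U := [set u | T (u, 0)].

(* The adjoint of T with respect to the (possibly indefinite) inner products
   bU and bV. *)
Definition adjoint_rel (bU : U -> U -> K) (bV : V -> V -> K)
    (T : set (U * V)) : set (V * U) :=
  [set p | forall u v, T (u, v) -> bV v p.1 = bU u p.2].

Definition unitary_rel (bU : U -> U -> K) (bV : V -> V -> K)
    (T : set (U * V)) :=
  linear_relation T /\ (T^-1)%relation = adjoint_rel bU bV T.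

End Relations.

Section HilbertRelations.
Variable R : realType.
Implicit Types H K : hilbertType R.

(* The product topology of H * H is the topology of the Hilbert space direct
   sum of H with itself, but the library's norm on H * H is the maximum norm;
   the inner product of the direct sum is therefore given explicitly. *)
Definition dsum_dotp H (p q : H * H) : R[i] := '[p.1, q.1] + '[p.2, q.2].

Definition fund_sym H (p : H * H) : H * H :=
  (- 'i%C *: p.2, 'i%C *: p.1).

Definition krein_form H (p q : H * H) : R[i] := dsum_dotp (fund_sym p) q.

Lemma krein_formE H (h h' k k' : H) :
  krein_form (h, h') (k, k') = - 'i%C * ('[h', k] - '[h, k']).
Proof.
rewrite /krein_form /dsum_dotp /= !linearZl_LR /=.
by rewrite mulrBr !mulNr opprK.
Qed.

(* The Hilbert space adjoint S^* of a linear relation S in H. *)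
Definition hilbert_adjoint H (S : set (H * H)) : set (H * H) :=
  adjoint_rel (fun x y => '[x, y]) (fun x y => '[x, y]) S.

Definition closed_symmetric H (S : set (H * H)) :=
  [/\ linear_relation S, closed S & S `<=` hilbert_adjoint S].

Definition green_identity H K (fh gk : (H * H) * (K * K)) :=
  '[fh.1.2, gk.1.1] - '[fh.1.1, gk.1.2] =
  '[fh.2.2, gk.2.1] - '[fh.2.1, gk.2.2].

(* "dom Gamma is dense in S^*" means that dom Gamma is a subset of S^* whose
   closure contains S^*. *)
Definition boundary_relation H K (S : set (H * H))
    (Gamma : set ((H * H) * (K * K))) :=
  [/\ linear_relation Gamma,
      Gamma.`1 `<=` hilbert_adjoint S /\
        hilbert_adjoint S `<=` closure Gamma.`1,
      forall fh gk, Gamma fh -> Gamma gk -> green_identity fh gk &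
      forall gk, (forall fh, Gamma fh -> green_identity fh gk) -> Gamma gk].

Definition weyl_family H K (Gamma : set ((H * H) * (K * K))) (lambda : R[i]) :
    set (K * K) :=
  [set h | exists f : H, Gamma ((f, lambda *: f), h)].

Definition gamma_field H K (Gamma : set ((H * H) * (K * K))) (lambda : R[i]) :
    set (K * H) :=
  [set p | exists h', Gamma ((p.2, lambda *: p.2), (p.1, h'))].

Definition shmulyan H K (W : set ((H * H) * (K * K))) (Theta : set (H * H)) :
    set (K * K) :=
  [set k | exists2 h, Theta h & W (h, k)].

End HilbertRelations.

(* Main.v *)
Require Import Defs.
From HB Require Import structures.
From mathcomp Require Import all_boot all_order all_algebra.
From mathcomp Require Import all_classical all_reals all_analysis.
From mathcomp Require Import sesquilinear complex.
From mathcomp Require Import ring.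

Set Implicit Arguments.
Unset Strict Implicit.
Unset Printing Implicit Defensive.

Import Order.TTheory GRing.Theory Num.Theory.
Import numFieldNormedType.Exports.

Local Open Scope classical_set_scope.
Local Open Scope relation_scope.
Local Open Scope ring_scope.

(** Parts (ii) and (iii) only unfold the composition of relations.  In (i), the
    Green identity and its maximality for T = W Gamma say exactly that T is
    unitary, because the form of the Krein space H^2 is -i times a side of the
    Green identity ([unitary_greenP]).  What has to be proved is that dom T,
    which is contained in dom Gamma and may be strictly smaller, is still dense
    in S^*.

    For any relation T that satisfies the Green identity and is maximal with
    this property, ker T is the orthogonal companion of dom T in the indefinite
    form ([ker_rel_greenP]).  Since ker W = {0}, the kernel of W Gamma lies in
    the kernel of Gamma.  Hence a vector orthogonal to dom T is orthogonal to
    dom Gamma, and by continuity to the closure of dom Gamma, which contains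
    S^*.  So S^* lies in the double orthogonal complement of dom T, and this is
    the closure of dom T.  The passage between the indefinite and the definite
    orthogonality is harmless, because the fundamental symmetry preserves the
    definite inner product ([fund_sym_isometry]).

    The fact that the double orthogonal complement of a subspace is its closure
    ([closure_double_orthogonal]) is the projection theorem.  It is proved for
    an inner product on a complete normed space which dominates the square of
    the norm and is continuous, rather than one which induces the norm: F * F
    carries the maximum norm, and only the weaker properties hold there. *)

(** * Inner products *)

Section InnerProduct.
Variables (C : numClosedFieldType) (V : lmodType C).
Variable B : {dot V for @Num.conj C}.

(** Minimality of the distance gives orthogonality, in a quantitative form that
    applies to the terms of a minimizing sequence: if moving u along w cannot
    lower the square of its length by more than e, then u is nearly orthogonal
    to w.  With the square of the length of u for e, the hypothesis is void and
    the conclusion is the Cauchy-Schwarz inequality. *)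
Lemma near_minimizer_orthogonal (u w : V) (e : C) :
  (forall c, B u u - e <= B (u - c *: w) (u - c *: w)) ->
  `|B u w| ^+ 2 <= e * B w w.
Proof.
have [->|w0] := eqVneq w 0.
  by rewrite linear0r linear0l normr0 expr0n mulr0.
have ww0 : 0 < B w w by rewrite dnorm_gt0.
(* The component of u along w, whose removal lowers the length the most. *)
move=> /(_ (B u w / B w w)).
rewrite dnormB dnormZ linearZr /=.
have wwR : (B w w)^-1^* = (B w w)^-1.
  by rewrite conj_Creal // rpredV gtr0_real.
rewrite normrM normfV (gtr0_norm ww0) !rmorphM /= conjCK !wwR.
set d := B u w; set q := B w w.
have -> : B u u + (`|d| / q) ^+ 2 * q - (d^* / q * d + d / q * d^*) =
  B u u - `|d| ^+ 2 / q.
  rewrite (_ : d^* / q * d = `|d| ^+ 2 / q); last by rewrite normCK; ring.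
  rewrite (_ : d / q * d^* = `|d| ^+ 2 / q); last by rewrite normCK; ring.
  by field; rewrite gt_eqF.
by rewrite lerD2l lerN2 ler_pdivrMr.
Qed.

Lemma dot_cauchy_schwarz (u w : V) : `|B u w| ^+ 2 <= B u u * B w w.
Proof.
by apply: near_minimizer_orthogonal => c; rewrite subrr dnorm_ge0.
Qed.

(** Written with the midpoint, which stays in a subspace containing u and v. *)
Lemma parallelogram (u v : V) :
  B (u - v) (u - v) =
  2 * B u u + 2 * B v v - 4 * B (2^-1 *: (u + v)) (2^-1 *: (u + v)).
Proof.
have h : (2 : C)^-1 >= 0 by rewrite invr_ge0 ler0n.
rewrite dnormZ dnormB dnormD (ger0_norm h).
by field.
Qed.

End InnerProduct.

(** * The projection theorem *)

(** The order of R[i] is partial, but it makes positive only the positive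
    reals, so R[i] is as archimedean as R. *)
Lemma near_infty_natSinv_ltC (R : realType) (e : R[i]) : 0 < e ->
  \forall n \near \oo, (n.+1%:R^-1 : R)%:C%C < e.
Proof.
move=> e0; have eR : (complex.Re e)%:C%C = e by rewrite RRe_real // gtr0_real.
have re0 : 0 < complex.Re e by rewrite -ltcR eR.
near=> n; rewrite -eR ltcR; near: n.
exact: (near_infty_natSinv_lt (PosNum re0)).
Unshelve. all: by end_near. Qed.

Section Projection.
Variables (R : realType) (V : completeNormedModType R[i]).
Variable B : {dot V for @Num.conj R[i]}.
Hypothesis norm_le_dot : forall x, `|x| ^+ 2 <= B x x.
Hypothesis dot_continuous : forall w, continuous (B^~ w).

Lemma orthogonal_closure (A : set V) (z : V) :
  (forall v, A v -> B v z = 0) -> forall v, closure A v -> B v z = 0.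
Proof.
move=> Az; have closed_orth : closed [set v | B v z = 0].
  apply: (@preimage_closed _ _ (B^~ z) [set 0]).
    by move=> v _; apply: dot_continuous.
  by apply: accessible_closed_set1; apply/hausdorff_accessible/norm_hausdorff.
rewrite closure_id in closed_orth.
suff : closure A `<=` [set v | B v z = 0] by apply.
by rewrite closed_orth; apply: closureS.
Qed.

Variables (D : set V) (x : V).
Hypothesis submodD : GRing.submod_closed [pred v | v \in D].

Let D0 : D 0. Proof. by case: submodD => + _; rewrite !inE. Qed.
Let DP a u v : D u -> D v -> D (a *: u + v).
Proof.
by case: submodD => _ h Du Dv; have := h a u v; rewrite !inE; apply.
Qed.

(** The squared distances are real numbers sitting in R[i], which is only
    partially ordered: their infimum delta is taken in R. *)
Lemma minimizing_sequence : exists (delta : R[i]) (y : nat -> V),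
  [/\ forall n, D (y n), forall v, D v -> delta <= B (x - v) (x - v) &
      forall n, B (x - y n) (x - y n) < delta + (n.+1%:R^-1 : R)%:C%C].
Proof.
pose q v := complex.Re (B (x - v) (x - v)).
have qE v : (q v)%:C%C = B (x - v) (x - v).
  by rewrite /q RRe_real // ger0_real // dnorm_ge0.
have lbE : has_lbound (q @` D).
  by exists 0 => _ [v _ <-]; rewrite -ler0c qE dnorm_ge0.
have infE : has_inf (q @` D) by split=> //; exists (q 0); exists 0.
have /choice[y Hy] : forall n : nat, exists v,
    D v /\ q v < inf (q @` D) + n.+1%:R^-1.
  move=> n; have [|_ [v Dv <-] qv] := @inf_adherent _ _ n.+1%:R^-1 _ infE.
    by rewrite invr_gt0.
  by exists v.
exists (inf (q @` D))%:C%C, y; split=> [n|v Dv|n]; first by case: (Hy n).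
- by rewrite -qE lecR; apply: ge_inf => //; exists v.
- by rewrite -qE -rmorphD /= ltcR; case: (Hy n).
Qed.

(** A sequence y in D minimizing the distance to x is a Cauchy sequence by the
    parallelogram identity.  Its limit l is in the closure of D, and x - l is
    orthogonal to D, hence to l as well, and to x by hypothesis.  So x - l is
    orthogonal to itself, and x = l. *)
Lemma closure_double_orthogonal :
  (forall z, (forall v, D v -> B v z = 0) -> B x z = 0) -> closure D x.
Proof.
move=> xDoo; have [delta [y [Dy leD ltD]]] := minimizing_sequence.
pose e n : R[i] := (n.+1%:R^-1 : R)%:C%C.
have e_le m n : (m <= n)%N -> e n <= e m.
  by move=> mn; rewrite lecR lef_pV2 ?posrE// ler_nat.
(* The midpoint of y m and y n is in D, so its squared distance to x is at
   least delta. *)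
have dist_y m n : (m <= n)%N -> `|y m - y n| ^+ 2 <= 4 * e m.
  move=> mn; apply: le_trans (norm_le_dot _) _.
  rewrite -[y m - y n]opprK hnormN /=.
  rewrite (_ : - (y m - y n) = (x - y m) - (x - y n)); last first.
    by rewrite !opprB [RHS]addrC subrKA.
  rewrite parallelogram.
  rewrite (_ : 2^-1 *: (x - y m + (x - y n)) =
    x - (2^-1 *: y m + (2^-1 *: y n + 0))); last first.
    rewrite addr0 addrACA -opprD scalerBr -scalerDr -mulr2n -[x *+ 2]scaler_nat.
    by rewrite scalerA mulVf ?pnatr_eq0 // scale1r.
  have Dm : D (2^-1 *: y m + (2^-1 *: y n + 0)) by do 2?apply: DP.
  have := leD _ Dm; have := ltD m; have := ltD n; have := e_le _ _ mn.
  rewrite -/(e m) -/(e n).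
  set a := B _ _; set b := B _ _; set c := B _ _ => h1 /ltW h2 /ltW h3 h4.
  rewrite (_ : 4 * e m = 2 * (delta + e m) + 2 * (delta + e m) - 4 * delta);
    last by ring.
  apply: lerB; last by rewrite ler_pM2l.
  apply: lerD; rewrite ler_pM2l //; apply: le_trans h2 _.
  by rewrite lerD2l.
have /cvg_ex[l yl] : cvg (y @ \oo).
  apply/cauchy_cvgP/cauchy_exP => eps eps0.
  have [|N _ HN] := @near_infty_natSinv_ltC R (eps ^+ 2 / 4).
    by rewrite divr_gt0 ?exprn_gt0.
  exists (y N); exists N => // n Nn /=; rewrite -ball_normE /=.
  rewrite -(ltr_pXn2r (n := 2)) ?nnegrE ?(ltW eps0) ?normr_ge0 //.
  apply: le_lt_trans (dist_y _ _ Nn) _.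
  by rewrite mulrC -ltr_pdivlMr //; apply: HN => /=.
have closDl : closure D l.
  apply: (closed_cvg (closure D) (@closed_closure _ _) _ l yl).
  by apply: nearW => n; apply: subset_closure.
have zD w : D w -> B (x - l) w = 0.
  move=> Dw; apply/eqP/negPn/negP; rewrite -normr_gt0 => s0.
  have near_min n : `|B (x - y n) w| ^+ 2 <= e n * B w w.
    apply: near_minimizer_orthogonal => c.
    have -> : x - y n - c *: w = x - (c *: w + y n).
      by rewrite opprD addrA addrAC.
    apply: le_trans (leD _ (DP c Dw (Dy n))).
    by rewrite lerBlDr ltW.
  (* The pairings of x - y n with w tend to that of x - l, and to 0. *)
  have cvg_z : B (x - y n) w @[n --> \oo] --> B (x - l) w.
    have zl : x - y n @[n --> \oo] --> x - l by apply: cvgB yl; apply: cvg_cst.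
    exact: (cvg_comp _ _ zl (@dot_continuous w (x - l))).
  have s20 : 0 < `|B (x - l) w| / 2 by rewrite divr_gt0.
  (* Adding 1 makes the divisor nonzero, whether or not w = 0. *)
  have q0 : 0 < B w w + 1 by rewrite ltr_wpDl // dnorm_ge0.
  have : \forall n \near \oo, e n < (`|B (x - l) w| / 2) ^+ 2 / (B w w + 1).
    by apply: near_infty_natSinv_ltC; rewrite divr_gt0 ?exprn_gt0.
  move/cvgrPdist_lt : cvg_z => /(_ _ s20) [N1 _ H1] [N2 _ H2].
  have {H1} := H1 (maxn N1 N2) (leq_maxl _ _).
  have {H2} /= := H2 (maxn N1 N2) (leq_maxr _ _).
  move: (maxn N1 N2) => n en zn.
  have : (`|B (x - l) w| / 2) ^+ 2 < `|B (x - y n) w| ^+ 2.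
    rewrite ltr_pXn2r ?nnegrE ?normr_ge0 ?ltW //.
    have := ler_distD (B (x - y n) w) (B (x - l) w) 0; rewrite !subr0.
    move=> /le_lt_trans /(_ (ltr_leD zn (lexx _))).
    by rewrite -ltrBlDl {1}(splitr `|B (x - l) w|) addrK.
  suff near_le : `|B (x - y n) w| ^+ 2 <= (`|B (x - l) w| / 2) ^+ 2.
    by move=> /lt_le_trans - /(_ _ near_le); rewrite ltxx.
  apply: le_trans (near_min n) _; move: en; rewrite ltr_pdivlMr // => /ltW.
  apply: le_trans; rewrite ler_wpM2l ?lerDl //.
  by rewrite ler0c invr_ge0.
have Dz v : D v -> B v (x - l) = 0.
  by move=> /zD zv; rewrite hermC /= zv rmorph0 mulr0.
have lz : B l (x - l) = 0 by apply: orthogonal_closure closDl.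
have /eqP : B (x - l) (x - l) = 0.
  by rewrite linearBl /= lz (xDoo _ Dz) subr0.
by rewrite dnorm_eq0 subr_eq0 => /eqP ->.
Qed.

End Projection.

(** * The direct sum of a Hilbert space with itself *)

Section ProductCompleteness.
Variables (K : numFieldType) (U V : completeNormedModType K).

(* This combines the normed space structure with the base point, so that the
   uniform product can be declared complete. *)
HB.instance Definition _ := NormedModule.on (U * V)%type.

Lemma ball_prod (p q : U * V) (eps : K) :
  ball p eps q -> ball p.1 eps q.1 /\ ball p.2 eps q.2.
Proof.
rewrite -!ball_normE /ball_ /= prod_normE comparable_gt_max; first by move/andP.
by rewrite real_comparable.
Qed.

Lemma prod_complete (G : set_system (U * V)) :
  ProperFilter G -> cauchy G -> cvg G.
Proof.
move=> GG /(cauchyP (R := K)) Gc.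
have /cauchy_cvgP/cvg_ex[a Ga] : cauchy (fst @ G).
  apply/(cauchyP (R := K)) => eps /Gc[p Gp]; exists p.1.
  by apply: (@filterS _ G _ (ball p eps)) Gp => q /ball_prod[].
have /cauchy_cvgP/cvg_ex[b Gb] : cauchy (snd @ G).
  apply/(cauchyP (R := K)) => eps /Gc[p Gp]; exists p.2.
  by apply: (@filterS _ G _ (ball p eps)) Gp => q /ball_prod[].
apply/cvg_ex; exists (a, b); apply: cvg_trans (cvg_pair Ga Gb) => A.
by apply: (@filterS _ G _ (fun p => A (p.1, p.2))) => -[].
Qed.

HB.instance Definition _ :=
  Uniform_isComplete.Build (U * V)%type prod_complete.

End ProductCompleteness.

Section DirectSum.
Variables (R : realType) (H : hilbertType R).
Implicit Types (p q : H * H).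

Lemma dotp_continuous (w : H) : continuous (fun v : H => '[v, w]).
Proof.
move=> v; apply/cvgrPdist_lt => eps eps0.
have q0 : 0 < '[w, w] + 1 by rewrite ltr_wpDl // dnorm_ge0.
(* The radius eps / sqrt ('[w, w] + 1) is the one that Cauchy-Schwarz asks
   for; the 1 covers the case w = 0. *)
have c0 : 0 < eps ^+ 2 / ('[w, w] + 1) by rewrite divr_gt0 ?exprn_gt0.
have r0 : 0 < sqrtC (eps ^+ 2 / ('[w, w] + 1)) by rewrite sqrtC_gt0.
have : \forall u \near v, `|v - u| < sqrtC (eps ^+ 2 / ('[w, w] + 1)).
  by apply/nbhs_normP; exists (sqrtC (eps ^+ 2 / ('[w, w] + 1))).
apply: filterS => u; rewrite -linearBl /=.
rewrite -(ltr_pXn2r (n := 2)) ?nnegrE ?(ltW r0) ?normr_ge0 // sqrtCK.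
rewrite ltr_pdivlMr // => uv.
rewrite -(ltr_pXn2r (n := 2)) ?nnegrE ?(ltW eps0) ?normr_ge0 //.
apply: le_lt_trans (dot_cauchy_schwarz _ _ _) _.
apply: le_lt_trans uv; rewrite sqr_norm_dotp ler_wpM2l ?dnorm_ge0 //.
by rewrite lerDl.
Qed.

Lemma dsum_dotp_bilinear :
  bilinear_for *%R (@Num.conj R[i] \; *%R)%FUN (@dsum_dotp R H).
Proof.
split=> u a p q; rewrite /dsum_dotp /=.
  by rewrite !linearPl /= mulrDr addrACA.
by rewrite !linearPr /= mulrDr addrACA.
Qed.

HB.instance Definition _ := bilinear_isBilinear.Build R[i] (H * H)%type
  (H * H)%type R[i] *%R (@Num.conj R[i] \; *%R)%FUN (@dsum_dotp R H)
  dsum_dotp_bilinear.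

Lemma dsum_dotp_hermitian p q :
  dsum_dotp p q = (-1) ^+ false * (dsum_dotp q p)^*.
Proof.
rewrite expr0 mul1r /dsum_dotp rmorphD /=.
by congr (_ + _); rewrite hermC expr0 mul1r.
Qed.

HB.instance Definition _ := isHermitianSesquilinear.Build R[i] (H * H)%type
  false (@Num.conj R[i]) (@dsum_dotp R H) dsum_dotp_hermitian.

Lemma dsum_dotp_gt0 p : p != 0 -> 0 < dsum_dotp p p.
Proof.
case: p => a b; rewrite /dsum_dotp /=.
have [->|a0 _] := eqVneq a 0.
  have [->|b0 _] := eqVneq b 0; first by rewrite eqxx.
  by rewrite ltr_wpDl ?dnorm_ge0 ?dnorm_gt0.
by rewrite ltr_pwDl ?dnorm_ge0 ?dnorm_gt0.
Qed.

HB.instance Definition _ := isDotProduct.Build R[i] (H * H)%type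
  (@dsum_dotp R H) dsum_dotp_gt0.

Lemma norm_le_dsum_dotp p : `|p| ^+ 2 <= dsum_dotp p p.
Proof.
rewrite prod_normE /dsum_dotp -!sqr_norm_dotp maxEle.
by case: ifP => _; rewrite ?lerDl ?lerDr exprn_ge0.
Qed.

Lemma dsum_dotp_continuous q :
  continuous (fun p : H * H => dsum_dotp p q : (R[i] : numFieldType)).
Proof.
move=> p; have p1 : r.1 @[r --> p] --> p.1 by apply: cvg_fst.
have p2 : r.2 @[r --> p] --> p.2 by apply: cvg_snd.
apply: cvgD.
  exact: (cvg_comp _ _ p1 (@dotp_continuous q.1 p.1)).
exact: (cvg_comp _ _ p2 (@dotp_continuous q.2 p.2)).
Qed.

Lemma fund_sym_isometry p q :
  dsum_dotp (fund_sym p) (fund_sym q) = dsum_dotp p q.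
Proof.
have ii : ('i%C)^* * 'i%C = 1 :> R[i].
  by rewrite mulrC -normCK normc_def /= expr0n expr1n add0r sqrtr1 expr1n.
rewrite /dsum_dotp /fund_sym /= !linearZl_LR !linearZr_LR /= /GRing.scale /=.
by rewrite !mulrA rmorphN mulrNN ii !mul1r addrC.
Qed.

End DirectSum.

(** * Green identities and unitary relations *)

Section Green.
Variables (R : realType) (F K : hilbertType R).
Implicit Type T : set ((F * F) * (K * K)).

(** The two sides differ from the Krein forms by the factor -i. *)
Lemma green_identityE (fh gk : (F * F) * (K * K)) :
  green_identity fh gk <-> krein_form fh.2 gk.2 = krein_form fh.1 gk.1.
Proof.
case: fh gk => [[f f'] [h h']] [[g g'] [k k']].
rewrite /green_identity !krein_formE /=; split=> [->//|/mulfI -> //].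
by rewrite oppr_eq0 eq_complex /= oner_eq0 andbF.
Qed.

Lemma unitary_greenP T gk :
  unitary_rel (@krein_form R F) (@krein_form R K) T ->
  T gk <-> forall fh, T fh -> green_identity fh gk.
Proof.
case: gk => g k [_ /(congr1 (fun A => A (k, g)))] /= ->.
split=> [adj [f h]|adj f h].
  by move=> /adj /= E; apply/green_identityE.
by move=> /adj /green_identityE.
Qed.

(** The pair (g, 0) belongs to T when it satisfies the Green identity against
    T, and there the side of the boundary space vanishes. *)
Lemma ker_rel_greenP T g :
  (forall gk, T gk <-> forall fh, T fh -> green_identity fh gk) ->
  ker_rel T g <-> forall f, T.`1 f -> krein_form f g = 0.
Proof.
move=> TP; have krein0 (h : K * K) : krein_form h 0 = 0.
  by rewrite /krein_form linear0r.
split=> [Tg f [h Tfh]|g0].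
  by have /TP/(_ _ Tfh)/green_identityE /= := Tg; rewrite krein0.
apply/TP => -[f h] Tfh; apply/green_identityE.
by rewrite /= krein0 g0 //; exists h.
Qed.

Lemma dom_linear T : linear_relation T ->
  GRing.submod_closed [pred f | f \in T.`1].
Proof.
move=> [T0 TD]; split; first by rewrite !inE in T0 *; exists 0.
move=> a u v; rewrite !inE => -[h Tu] [k Tv]; exists (a *: h + k).
by have := TD a (u, h) (v, k); rewrite !inE; apply.
Qed.

End Green.

(** * Boundary relations under composition *)

Unset Implicit Arguments.

Theorem proposition3p10 (R : realType) (F H K : hilbertType R)
  (S : set (F * F)) (Gamma : set ((F * F) * (H * H)))
  (W : set ((H * H) * (K * K)))
  (hS : closed_symmetric S)
  (hGamma : boundary_relation S Gamma)
  (hW : linear_relation W)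
  (hWGamma : unitary_rel (@krein_form R F) (@krein_form R K) (W \; Gamma))
  (kerW : ker_rel W = [set 0]) :
  [/\ boundary_relation S (W \; Gamma),
      forall lambda : R[i], lambda \isn't Num.real ->
        gamma_field (W \; Gamma) lambda =
        [set p : K * F | exists (k' : K) (h : H * H),
           W (h, (p.1, k')) /\ Gamma ((p.2, lambda *: p.2), h)] &
      forall lambda : R[i], lambda \isn't Num.real ->
        weyl_family (W \; Gamma) lambda =
        shmulyan W (weyl_family Gamma lambda)].
Proof.
split; last 2 first.
- move=> lambda _; apply/seteqP; split=> -[k f].
    by move=> [k' [h Gfh Whk]]; exists k', h.
  by move=> [k' [h [Whk Gfh]]]; exists k', h.
- move=> lambda _; apply/seteqP; split=> k.
    by move=> [f [h Gfh Whk]]; exists h => //; exists f.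
  by move=> [h [f Gfh] Whk]; exists f, h.
have [_ [domG S_clG] G1 G2] := hGamma.
have GP gk : Gamma gk <-> forall fh, Gamma fh -> green_identity fh gk.
  by split=> [Ggk fh Gfh|]; [exact: G1|exact: G2].
have TP gk := unitary_greenP gk hWGamma.
have linT : linear_relation (W \; Gamma) by case: hWGamma.
split=> //; last 2 first.
- by move=> fh gk Tfh /TP; apply.
- by move=> gk /TP.
split=> [f [k [h Gfh _]]|p Sp]; first by apply: domG; exists h.
have kerG g : ker_rel (W \; Gamma) g -> ker_rel Gamma g.
  move=> [h Ggh Wh0]; have : ker_rel W h by [].
  by rewrite kerW => h0; rewrite /ker_rel /= -[X in (g, X)]h0.
apply: (closure_double_orthogonal (@norm_le_dsum_dotp R F)
  (@dsum_dotp_continuous R F) (dom_linear linT)) => z zT.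
(* Orthogonality to z in the definite inner product is orthogonality to
   fund_sym z in the indefinite one. *)
have /kerG /(ker_rel_greenP _ GP) zG : ker_rel (W \; Gamma) (fund_sym z).
  apply/(ker_rel_greenP _ TP) => f Tf.
  by rewrite /krein_form fund_sym_isometry; apply: zT.
apply: (orthogonal_closure (@dsum_dotp_continuous R F) _ (S_clG _ Sp)) => f Gf.
by have := zG f Gf; rewrite /krein_form fund_sym_isometry.
Qed.
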